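(* There exists $n_0$ such that for every integer $n\ge n_0$ there is a coupling of $S_n$ with a standard Gaussian random variable $Z\sim N(0,1)$ such that (almost surely) $$|S_n|\le |Z|\sqrt{n}+3\qquad\text{and}\qquad |S_n-Z\sqrt{n}|\le Z^2+11.$$
   Context: $S_n=X_1+\ldots+X_n$ where $X_1,X_2,\ldots$ are i.i.d. symmetric Bernoulli random variables, i.e., $X_i=\pm1$ with probability $1/2$ each. A coupling of random variables $X,Y$ satisfying certain statements means a probability space carrying random variables with the same marginal distributions as $X$ and $Y$ respectively and satisfying the stated mutual relationships. *)

(* Defs.v *)
From HB Require Import structures.
From mathcomp Require Import all_boot all_order all_algebra finmap.
From mathcomp Require Import all_classical all_reals all_analysis measurable_realfun.

Set Implicit Arguments.
Unset Strict Implicit.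
Unset Printing Implicit Defensive.

Import Order.TTheory GRing.Theory Num.Theory.
Import numFieldNormedType.Exports.

Local Open Scope classical_set_scope.
Local Open Scope ring_scope.

Section coupling.
Context (R : realType) (d : measure_display) (T : measurableType d)
  (P : probability T R).

Definition mutually_independent (X : nat -> {RV P >-> R}) : Prop :=
  forall (J : {fset nat}) (A : nat -> set R),
    (forall i, measurable (A i)) ->
    P (\bigcap_(i in [set` J]) (X i @^-1` A i)) =
    (\prod_(i <- J) P (X i @^-1` A i))%E.

Definition symmetric_bernoulli (X : {RV P >-> R}) : Prop :=
  P [set w | X w = 1] = (2^-1)%:E /\ P [set w | X w = -1] = (2^-1)%:E.

(* Identical distribution holds because every [X i] has the same prescribed law. *)
Definition iid_symmetric_bernoulli (X : nat -> {RV P >-> R}) : Prop :=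
  mutually_independent X /\ forall i, symmetric_bernoulli (X i).

(* [X] is indexed from 0, so this is the sum of the first [n] variables. *)
Definition partial_sum (X : nat -> {RV P >-> R}) (n : nat) : {RV P >-> R} :=
  (\sum_(i < n) (X i : {mfun T >-> R}) : {mfun T >-> R}).

(* Laws are compared on measurable sets only: the library's measures are total
   functions on [set R], with unspecified values off the sigma-algebra. *)
Definition has_law (X : {RV P >-> R}) (mu : set R -> \bar R) : Prop :=
  forall A : set R, measurable A -> distribution P X A = mu A.

End coupling.

(* Main.v *)
(** S and Z are coupled by the quantile transform on (R, N(0,1)): Z is the
    identity and S the step function of thresholds [t i] chosen so that the
    Gaussian mass above [t i] equals the binomial mass of the lattice points
    [2 j - n] with [j >= i].  Both bounds are then statements on the [t i], and
    these follow from tail comparisons obtained by summing local ones.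

    Consecutive binomial weights ending at the lattice point [l] have ratio
    [(1 - x) / (1 + x)] with [x = (l - 1) / (n + 1)], which lies between
    [exp (- 2 x - x^3)] and [exp (- 2 x)], and the central weight is pinned down
    to a factor [exp (- 1 / n)] by Wallis' product.  Hence the weight of [l] is
    at most the Gaussian mass of [[l - 3, l - 1] / sqrt n], and for [l <= n / 2]
    at least that of [[h (l + 9), h (l + 11)] / sqrt n], where
    [h w = w + w^2 / n]: the quadratic term of [h] absorbs the quartic error of
    the binomial weights.  The first bound gives [|S| <= |Z| sqrt n + 3].  The
    second one gives [Z sqrt n <= h w] with [w = S + 11], and
    [Z sqrt n > w + Z^2] would force [Z sqrt n > w + w^2 / n = h w]; it is
        needed
    only for [w < n / 4], since always [Z sqrt n - Z^2 <= n / 4]. *)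

Require Import Defs.
From HB Require Import structures.
From mathcomp Require Import all_boot all_order all_algebra finmap.
From mathcomp Require Import all_classical all_reals all_analysis measurable_realfun.
From mathcomp Require Import ring lra zify.

Import Order.TTheory GRing.Theory Num.Theory.
Import numFieldNormedType.Exports.

Local Open Scope classical_set_scope.
Local Open Scope ring_scope.

(** * Bounds on (1 - x) / (1 + x) *)

(** Most analytic inequalities below come from this lemma, applied to the difference of the two
    sides. *)
Lemma is_derive_nondecreasing (R : realType) (f g : R -> R) (a b : R) :
  a <= b -> (forall x, a <= x <= b -> is_derive x 1 f (g x)) ->
  (forall x, a <= x <= b -> 0 <= g x) -> f a <= f b.
Proof.
move=> ab df g0.
have dv x : x \in `[a, b] -> derivable f x 1.
  by rewrite in_itv/= => /df H; exact: ex_derive.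
apply: (@ger0_derive1_le_cc R f a b) => //.
- by move=> x /subset_itv_oo_cc; exact: dv.
- move=> x /subset_itv_oo_cc; rewrite in_itv/= => xab.
  by rewrite derive1E; have H := df x xab; rewrite derive_val; exact: g0.
- exact: derivable_within_continuous.
- by rewrite in_itv/= lexx.
- by rewrite in_itv/= lexx andbT.
Qed.

Lemma is_derive_ln_ratio (R : realType) (y : R) : -1 < y < 1 ->
  is_derive y 1 (fun z : R => ln (1 + z) - ln (1 - z)) (2 / (1 - y ^+ 2)).
Proof.
move=> /andP[y0 y1].
have H1 : is_derive y 1 (fun z : R => ln (1 + z)) ((1 + y)^-1 * (0 + 1)).
  apply: (@is_derive1_comp R (@ln R) (fun z => 1 + z)).
  by apply: is_derive1_ln; lra.
have H2 : is_derive y 1 (fun z : R => ln (1 - z)) ((1 - y)^-1 * (0 - 1)).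
  apply: (@is_derive1_comp R (@ln R) (fun z => 1 - z)).
  by apply: is_derive1_ln; lra.
apply: is_derive_eq; field.
by repeat (apply/andP; split); apply/eqP; nra.
Qed.

Lemma ln_ratioE (R : realType) (x : R) : 0 <= x < 1 ->
  (1 - x) / (1 + x) = expR (- (ln (1 + x) - ln (1 - x))).
Proof.
move=> /andP[x0 x1].
by rewrite opprB expRD expRN !lnK// posrE; lra.
Qed.

(** The function [ln (1 + y) - ln (1 - y) - 2 * y] vanishes at 0 and has derivative
    [2 / (1 - y ^+ 2) - 2 >= 0]. *)
Lemma ratio_le_expR (R : realType) (x : R) : 0 <= x < 1 ->
  (1 - x) / (1 + x) <= expR (- (2 * x)).
Proof.
move=> x01; rewrite ln_ratioE// ler_expR lerN2.
have /andP[x0 x1] := x01.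
suff : (ln (1 + 0) - ln (1 - 0)) - 2 * 0 <= (ln (1 + x) - ln (1 - x)) - 2 * x.
  by rewrite addr0 subr0 ln1; lra.
apply: (@is_derive_nondecreasing R
  (fun y => (ln (1 + y) - ln (1 - y)) - 2 * y) (fun y => 2 / (1 - y ^+ 2) - 2))
      => //.
- move=> y /andP[y0 yx].
  have H : is_derive y 1 (fun z : R => ln (1 + z) - ln (1 - z)) (2 / (1 - y ^+
      2)).
    by apply: is_derive_ln_ratio; lra.
  have H2 : is_derive y 1 (fun z : R => 2 * z) (2 *: 1) by exact: is_deriveZ.
  by apply: is_derive_eq; rewrite scaler1.
- move=> y /andP[y0 yx].
  by rewrite subr_ge0 ler_pdivlMr; nra.
Qed.

(** The expansion of [ln (1 + x) - ln (1 - x)] starts with [2 * x + 2 / 3 * x ^+ 3]. Coefficient 1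
    at the cube absorbs the higher terms as long as [3 * x ^+ 2 <= 1], which [x <= 2^-1] ensures. *)
Lemma ratio_ge_expR (R : realType) (x : R) : 0 <= x <= 2^-1 ->
  expR (- (2 * x + x ^+ 3)) <= (1 - x) / (1 + x).
Proof.
move=> /andP[x0 x1]; rewrite ln_ratioE; last by lra.
rewrite ler_expR lerN2.
suff : 2 * 0 + 0 ^+ 3 - (ln (1 + 0) - ln (1 - 0)) <=
       2 * x + x ^+ 3 - (ln (1 + x) - ln (1 - x)).
  by rewrite addr0 subr0 ln1; lra.
apply: (@is_derive_nondecreasing R
  (fun y => 2 * y + y ^+ 3 - (ln (1 + y) - ln (1 - y)))
  (fun y => 2 + 3 * y ^+ 2 - 2 / (1 - y ^+ 2))) => //.
- move=> y /andP[y0 yx].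
  have H : is_derive y 1 (fun z : R => ln (1 + z) - ln (1 - z)) (2 / (1 - y ^+
      2)).
    by apply: is_derive_ln_ratio; lra.
  have H2 : is_derive y 1 (fun z : R => 2 * z) (2 *: 1) by exact: is_deriveZ.
  have H3 : is_derive y 1 (fun z : R => z ^+ 3) (3 * y ^+ 2 * 1).
    by apply: is_derive_eq; rewrite /= /GRing.scale /=; ring.
  by apply: is_derive_eq; rewrite scaler1; ring.
- move=> y /andP[y0 yx].
  rewrite subr_ge0 ler_pdivrMr; last by nra.
  (* This product equals [(2 + 3 * y ^+ 2) * (1 - y ^+ 2) - 2]. *)
  have : 0 <= y ^+ 2 * (1 - 3 * y ^+ 2) by apply: mulr_ge0; nra.
  nra.
Qed.

(** * Wallis' product *)

(* A primitive of [cos ^+ n], so that its values at [pi / 2] are the Wallis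
   integrals and no integration is needed. *)
Fixpoint cos_pow_primitive {R : realType} (n : nat) (x : R) : R :=
  match n with
  | 0 => x
  | 1 => sin x
  | m.+2 => (cos x ^+ m.+1 * sin x + m.+1%:R * cos_pow_primitive m x) / m.+2%:R
  end.

Lemma cos_pow_primitiveSS (R : realType) m (x : R) :
  cos_pow_primitive m.+2 x =
  (cos x ^+ m.+1 * sin x + m.+1%:R * cos_pow_primitive m x) / m.+2%:R.
Proof. by []. Qed.

Lemma is_derive_cos_pow_primitive (R : realType) (n : nat) (x : R) :
  is_derive x 1 (cos_pow_primitive n) (cos x ^+ n).
Proof.
(* The recursion goes down by two, so two consecutive exponents are carried through the
   induction. *)
suff [] : is_derive x 1 (cos_pow_primitive n) (cos x ^+ n) /\
  is_derive x 1 (cos_pow_primitive n.+1) (cos x ^+ n.+1) by [].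
elim: n => [|n [IH1 IH2]]; split => //.
- by rewrite expr0; exact: is_derive_id.
- by rewrite expr1; exact: is_derive_sin.
have Hc : is_derive x 1 (fun z : R => cos z ^+ n.+1) (n.+1%:R * cos x ^+ n * -
    sin x).
  have : is_derive x 1 (cos ^+ n.+1 : R -> R) (n.+1%:R * cos x ^+ n *: - sin x)
      by exact: is_deriveX.
  suff -> : (cos ^+ n.+1 : R -> R) = (fun z : R => cos z ^+ n.+1) by [].
  by apply/funext => z; rewrite fctE.
have Hm : is_derive x 1 (fun z : R => cos z ^+ n.+1 * sin z)
   (cos x ^+ n.+1 * cos x + sin x * (n.+1%:R * cos x ^+ n * - sin x)).
  exact: is_deriveM.
have Hz : is_derive x 1 (fun z : R => n.+1%:R * cos_pow_primitive n z)
   (n.+1%:R *: cos x ^+ n) by exact: is_deriveZ.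
have Hs : is_derive x 1 (fun z : R => n.+2%:R^-1 *: (cos z ^+ n.+1 * sin z +
    n.+1%:R * cos_pow_primitive n z))
   (n.+2%:R^-1 *: ((cos x ^+ n.+1 * cos x + sin x * (n.+1%:R * cos x ^+ n * -
       sin x)) +
     (n.+1%:R *: cos x ^+ n))).
  exact: is_deriveZ.
have -> : cos_pow_primitive n.+2 = (fun z : R => n.+2%:R^-1 *: (cos z ^+ n.+1 *
    sin z + n.+1%:R * cos_pow_primitive n z)).
  by apply/funext => z /=; rewrite /GRing.scale /= mulrC.
apply: is_derive_eq.
have sc : sin x ^+ 2 = 1 - cos x ^+ 2 by rewrite -(cos2Dsin2 x); ring.
have -> : sin x * (n.+1%:R * cos x ^+ n * - sin x) = - n.+1%:R * cos x ^+ n *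
    sin x ^+ 2 by ring.
rewrite sc /GRing.scale /= !exprS.
have -> : n.+2%:R = n.+1%:R + 1 :> R by rewrite -natr1.
have : 0 < n.+1%:R :> R by rewrite ltr0n.
move: n.+1%:R => k k0; field; apply: lt0r_neq0; lra.
Qed.

(** The probability that [2 m] fair signs sum to 0. *)
Definition central_binomial_prob (R : realType) (m : nat) : R :=
  'C(m.*2, m)%:R / 4 ^+ m.

Lemma central_binomial_prob_gt0 (R : realType) m : 0 < central_binomial_prob R
    m.
Proof.
by rewrite divr_gt0 ?exprn_gt0// ltr0n bin_gt0 -addnn leq_addr.
Qed.

Lemma central_binomial_probS (R : realType) m :
  central_binomial_prob R m.+1 =
  central_binomial_prob R m * (m.*2.+1%:R / m.*2.+2%:R).
Proof.
have E1 : (m.+1 * m.+1 * 'C(m.+1.*2, m.+1) = m.*2.+2 * m.*2.+1 * 'C(m.*2, m))%N.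
  have H1 := mul_bin_diag m.*2.+2 m; rewrite /= in H1.
  have H2 := mul_bin_down m.*2.+1 m; rewrite /= in H2.
  rewrite (_ : m.*2.+1 - m = m.+1)%N in H2; last by lia.
  by rewrite doubleS -mulnA -H1 -mulnA H2 mulnCA.
rewrite /central_binomial_prob exprS.
have E2 : m.+1%:R * m.+1%:R * 'C(m.+1.*2, m.+1)%:R = m.*2.+2%:R * m.*2.+1%:R *
    'C(m.*2, m)%:R :> R.
  by rewrite -!natrM E1.
have e2 : m.*2.+2%:R = 2 * m.+1%:R :> R by rewrite -doubleS -mul2n natrM.
rewrite e2 in E2 *.
have m0 : m.+1%:R != 0 :> R by rewrite pnatr_eq0.
have -> : 'C(m.+1.*2, m.+1)%:R = (2 * m.+1%:R * m.*2.+1%:R * 'C(m.*2, m)%:R) /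
    (m.+1%:R * m.+1%:R) :> R.
  by rewrite -E2; field.
have : 4 ^+ m != 0 :> R by rewrite expf_neq0.
move: m0; move: (m.+1%:R : R) (4 ^+ m) (m.*2.+1%:R) => k p q k0 p0.
by field; rewrite ?k0 ?p0.
Qed.

(** At [pi / 2] the boundary term of the recursion vanishes, which leaves exactly the factor of
    [central_binomial_probS]. *)
Lemma cos_pow_primitive_double (R : realType) m :
  cos_pow_primitive m.*2 (pi / 2 : R) = pi / 2 * central_binomial_prob R m.
Proof.
elim: m => [|m IH]; first by rewrite /central_binomial_prob bin0 expr0 divr1
    mulr1.
rewrite doubleS /= IH cos_pihalf expr0n mul0r add0r central_binomial_probS;
    ring.
Qed.

Lemma cos_pow_primitive_doubleS (R : realType) m :
  cos_pow_primitive m.*2.+1 (pi / 2 : R) =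
  (m.*2.+1%:R * central_binomial_prob R m)^-1.
Proof.
elim: m => [|m IH]; first by rewrite /central_binomial_prob bin0 expr0 divr1
    mulr1 invr1 /= sin_pihalf.
rewrite doubleS cos_pow_primitiveSS IH cos_pihalf expr0n mul0r add0r
    central_binomial_probS.
have b0 := lt0r_neq0 (central_binomial_prob_gt0 R m).
have : m.*2.+1%:R != 0 :> R by rewrite pnatr_eq0.
have : m.*2.+2%:R != 0 :> R by rewrite pnatr_eq0.
have : m.*2.+3%:R != 0 :> R by rewrite pnatr_eq0.
move: (m.*2.+1%:R : R) (m.*2.+2%:R : R) (m.*2.+3%:R : R) => p q r r0 q0 p0.
by field; rewrite ?b0 ?p0 ?q0 ?r0.
Qed.

Lemma cos_pow_primitive0 (R : realType) m : cos_pow_primitive m (0 : R) = 0.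
Proof.
suff [] : cos_pow_primitive m (0 : R) = 0 /\ cos_pow_primitive m.+1 (0 : R) = 0
    by [].
elim: m => [|m [IH1 IH2]]; split => //=; first exact: sin0.
by rewrite IH1 sin0 !mulr0 addr0 mul0r.
Qed.

(** Both primitives vanish at 0, and [cos x ^+ m - cos x ^+ m.+1] is nonnegative on
    [[0, pi / 2]]. *)
Lemma cos_pow_primitive_nonincreasing (R : realType) m :
  cos_pow_primitive m.+1 (pi / 2 : R) <= cos_pow_primitive m (pi / 2).
Proof.
have pi0 := pi_gt0 R.
suff : cos_pow_primitive m (0 : R) - cos_pow_primitive m.+1 0 <=
  cos_pow_primitive m (pi / 2) - cos_pow_primitive m.+1 (pi / 2).
  by rewrite !cos_pow_primitive0 subr0 subr_ge0.
apply: (@is_derive_nondecreasing R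
  (fun x => cos_pow_primitive m x - cos_pow_primitive m.+1 x)
  (fun x => cos x ^+ m - cos x ^+ m.+1)).
- lra.
- move=> x _; have H1 := is_derive_cos_pow_primitive R m x.
  by have H2 := is_derive_cos_pow_primitive R m.+1 x; exact: is_deriveB.
- move=> x /andP[x0 x1]; have c0 : 0 <= cos x by apply: cos_ge0_pihalf; lra.
  rewrite subr_ge0 exprS ler_piMl ?exprn_ge0//; exact: cos_le1.
Qed.

(** Wallis' comparison for the exponents [2 m] and [2 m + 1]: with [b] the central probability it
    reads [1 / ((2 m + 1) b) <= (pi / 2) b]. *)
Lemma central_binomial_prob_sqr_ge (R : realType) m :
  2 / (pi * m.*2.+1%:R) <= central_binomial_prob R m ^+ 2.
Proof.
have := cos_pow_primitive_nonincreasing R m.*2.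
rewrite cos_pow_primitive_doubleS cos_pow_primitive_double.
have b0 := central_binomial_prob_gt0 R m.
have pi0 := pi_gt0 R.
have m0 : 0 < m.*2.+1%:R :> R by rewrite ltr0n.
move: (central_binomial_prob R m) b0 (m.*2.+1%:R : R) m0 => b b0 k k0.
rewrite -[X in X <= _]div1r ler_pdivrMr ?mulr_gt0// => H.
rewrite ler_pdivrMr ?mulr_gt0//; nra.
Qed.

(** The same comparison for the exponents [2 m + 1] and [2 m + 2], where the odd value is rewritten
    by [(2 m + 1) b_m = (2 m + 2) b_(m+1)]. *)
Lemma central_binomial_prob_sqr_le (R : realType) m :
  central_binomial_prob R m.+1 ^+ 2 <= 2 / (pi * m.+1.*2%:R).
Proof.
have := cos_pow_primitive_nonincreasing R m.*2.+1.
rewrite -doubleS cos_pow_primitive_doubleS cos_pow_primitive_double.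
have -> : m.*2.+1%:R * central_binomial_prob R m = m.+1.*2%:R *
    central_binomial_prob R m.+1.
  by rewrite central_binomial_probS doubleS [RHS]mulrC -mulrA divfK
      ?pnatr_eq0// mulrC.
have b0 := central_binomial_prob_gt0 R m.+1.
have pi0 := pi_gt0 R.
have m0 : 0 < m.+1.*2%:R :> R by rewrite ltr0n.
move: (central_binomial_prob R m.+1) b0 (m.+1.*2%:R : R) m0 => b b0 k k0.
rewrite -[X in _ <= X -> _]div1r ler_pdivlMr ?mulr_gt0// => H.
rewrite ler_pdivlMr ?mulr_gt0//; nra.
Qed.

(** * Binomial weights *)

Definition binomial_half (R : realType) (n i : nat) : R := 'C(n, i)%:R / 2 ^+ n.

(** The value of a sum of [n] signs, [i] of which are [+1]. *)
Definition lattice_point (R : realType) (n i : nat) : R := 2 * i%:R - n%:R.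

Lemma binomial_half_gt0 (R : realType) n i : (i <= n)%N -> 0 < binomial_half R
    n i.
Proof. by move=> le_in; rewrite divr_gt0 ?exprn_gt0// ltr0n bin_gt0. Qed.

Lemma binomial_half_ge0 (R : realType) n i : 0 <= binomial_half R n i.
Proof. by rewrite divr_ge0 ?exprn_ge0. Qed.

Lemma binomial_half_sub (R : realType) n i : (i <= n)%N ->
  binomial_half R n (n - i) = binomial_half R n i.
Proof. by move=> le_in; rewrite /binomial_half bin_sub. Qed.

Lemma sum_binomial_half (R : realType) n :
  \sum_(0 <= i < n.+1) binomial_half R n i = 1.
Proof.
rewrite -mulr_suml big_mkord -natr_sum.
have -> : (\sum_(i < n.+1) 'C(n, i) = 2 ^ n)%N.
  by rewrite (expnDn 1 1); apply: eq_bigr => i _; rewrite !exp1n !muln1.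
by rewrite natrX divff// expf_neq0.
Qed.

(** Thus [uphalf n] is the first index with a nonnegative lattice point; the inductions over
    binomial weights start there. *)
Lemma lattice_point_uphalf (R : realType) n :
  lattice_point R n (uphalf n) = (odd n)%:R.
Proof.
rewrite /lattice_point -natrM -[in X in _ - X](odd_double_half n) uphalf_half.
rewrite mul2n doubleD natrD [(_ + _./2.*2)%:R]natrD opprD addrACA subrr addr0.
case: (odd n) => /=; rewrite ?subrr ?subr0 ?double0 //; rewrite (_ : 1.*2 =
    2)%N //; lra.
Qed.

Lemma lattice_pointS (R : realType) n i :
  lattice_point R n i.+1 = lattice_point R n i + 2.
Proof. by rewrite /lattice_point -natr1; ring. Qed.

(** For odd [n = 2 m + 1] the two middle coefficients agree and add up to ['C(2 m + 2, m + 1)], so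
    both parities reduce to a central probability of even order. *)
Lemma binomial_half_uphalf (R : realType) n :
  binomial_half R n (uphalf n) = central_binomial_prob R (uphalf n).
Proof.
rewrite /binomial_half /central_binomial_prob.
have -> : (4 : R) = 2 ^+ 2 by rewrite -natrX.
rewrite -exprM mul2n.
have [m [->|->]] : exists m, n = m.*2 \/ n = m.*2.+1.
  by exists n./2; have := odd_double_half n; case: odd => E; [right|left];
      rewrite -[LHS]E.
- by rewrite uphalf_double.
rewrite [uphalf _]/= half_double doubleS [in RHS]binS.
have -> : 'C(m.*2.+1, m) = 'C(m.*2.+1, m.+1).
  by rewrite -[RHS]bin_sub; [congr 'C(_, _)|]; lia.
by rewrite [in RHS]exprS addnn -(mul2n 'C(_, _)) natrM -mulf_div divff ?mul1r.
Qed.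

(** Here [1 - x = 2 (n - i) / (n + 1)] and [1 + x = 2 (i + 1) / (n + 1)]. *)
Lemma binomial_half_ratio (R : realType) n i : (i < n)%N ->
  let x := (lattice_point R n i + 1) / n.+1%:R in
  binomial_half R n i.+1 = binomial_half R n i * ((1 - x) / (1 + x)).
Proof.
move=> lt_in x.
have E : i.+1%:R * 'C(n, i.+1)%:R = (n%:R - i%:R) * 'C(n, i)%:R :> R.
  by rewrite -natrB ?(ltnW lt_in)// -!natrM mul_bin_left.
have i0 : i.+1%:R != 0 :> R by rewrite pnatr_eq0.
have n0 : n.+1%:R != 0 :> R by rewrite pnatr_eq0.
have -> : (1 - x) / (1 + x) = (n%:R - i%:R) / i.+1%:R.
  rewrite /x /lattice_point; move: i0 n0; rewrite -!natr1.
  move: (i%:R : R) (n%:R : R) => u v u0 v0; field.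
  rewrite u0 v0 /=.
  have -> : v + 1 + (2 * u - v + 1) = 2 * (u + 1) by ring.
  by rewrite mulf_neq0.
rewrite /binomial_half; apply: (mulfI i0).
rewrite mulrA E; move: i0; move: (i.+1%:R : R) => k k0.
have p0 : 2 ^+ n != 0 :> R by rewrite expf_neq0.
by field; rewrite ?k0 ?p0.
Qed.

(** The Gaussian density at 0 times the rescaled lattice spacing [2 / sqrt n], that is
    [sqrt (2 / (pi n))]. *)
Definition peak_scale (R : realType) (n : nat) : R :=
  2 * normal_peak 1 / Num.sqrt n%:R.

Lemma normal_peak1_sqr (R : realType) : (normal_peak 1 : R) ^+ 2 = (pi * 2)^-1.
Proof.
rewrite /normal_peak expr1n mul1r exprVn sqr_sqrtr ?mulr_natr//.
by rewrite mulrn_wge0// pi_ge0.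
Qed.

Lemma peak_scale_gt0 (R : realType) n : (0 < n)%N -> 0 < peak_scale R n.
Proof.
move=> n0; rewrite /peak_scale divr_gt0 ?mulr_gt0 ?normal_peak_gt0 ?oner_eq0//.
by rewrite sqrtr_gt0 ltr0n.
Qed.

Lemma peak_scale_sqr (R : realType) n : (0 < n)%N ->
  peak_scale R n ^+ 2 = 2 / (pi * n%:R).
Proof.
move=> n0; rewrite /peak_scale exprMn exprVn sqr_sqrtr ?ler0n// exprMn
    normal_peak1_sqr.
have : n%:R != 0 :> R by rewrite pnatr_eq0 -lt0n.
have := lt0r_neq0 (pi_gt0 R).
move: (pi : R) (n%:R : R) => p k p0 k0; field.
by rewrite ?p0 ?k0.
Qed.

Lemma binomial_half_uphalf_le (R : realType) n : (0 < n)%N ->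
  binomial_half R n (uphalf n) <= peak_scale R n.
Proof.
move=> n0; rewrite binomial_half_uphalf.
have [m Em] : exists m, uphalf n = m.+1 by exists (uphalf n).-1; lia.
rewrite -(@ler_pXn2r _ 2%N)// ?nnegrE; last 2 first.
- exact/ltW/central_binomial_prob_gt0.
- exact/ltW/peak_scale_gt0.
rewrite Em peak_scale_sqr//; apply: (le_trans (central_binomial_prob_sqr_le R
    m)).
rewrite ler_pM2l// lef_pV2 ?posrE ?mulr_gt0 ?pi_gt0 ?ltr0n//.
by rewrite ler_pM2l ?pi_gt0// ler_nat; lia.
Qed.

(** After squaring, the loss is the factor [n / (n + 2)], which is at least [expR (- 2 / n)] because
    [1 + 2 / n <= expR (2 / n)]. *)
Lemma binomial_half_uphalf_ge (R : realType) n : (0 < n)%N ->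
  peak_scale R n * expR (- n%:R^-1) <= binomial_half R n (uphalf n).
Proof.
move=> n0; rewrite binomial_half_uphalf.
have ps0 := peak_scale_gt0 R n n0.
rewrite -(@ler_pXn2r _ 2%N)// ?nnegrE; last 2 first.
- by rewrite mulr_ge0 ?expR_ge0// ltW.
- exact/ltW/central_binomial_prob_gt0.
apply: le_trans (central_binomial_prob_sqr_ge R (uphalf n)).
rewrite exprMn peak_scale_sqr// -expRM_natl.
have pi0 := pi_gt0 R.
have nR : 0 < n%:R :> R by rewrite ltr0n.
apply: (@le_trans _ _ (2 / (pi * (n%:R + 2)))); last first.
  have n2 : 0 < n%:R + 2 :> R by lra.
  have u0 : 0 < (uphalf n).*2.+1%:R :> R by rewrite ltr0n.
  rewrite ler_pM2l// lef_pV2 ?posrE ?(mulr_gt0 pi0)//.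
  by rewrite ler_pM2l// -natrD ler_nat; lia.
have H := expR_ge1Dx (2 * n%:R^-1 : R).
rewrite mulrN expRN.
apply: (@le_trans _ _ (2 / (pi * n%:R) / (1 + 2 * n%:R^-1))).
  have v0 : 0 < n%:R^-1 :> R by rewrite invr_gt0.
  rewrite ler_pM2l ?divr_gt0 ?mulr_gt0// lef_pV2 ?posrE ?expR_gt0//; lra.
suff -> : 2 / (pi * n%:R) / (1 + 2 * n%:R^-1) = 2 / (pi * (n%:R + 2)) :> R by
    [].
by field; repeat (apply/andP; split); apply: lt0r_neq0 => //; lra.
Qed.

(** The exponents of the ratio bounds telescope, since [(l + 2) ^+ 2 - l ^+ 2 = 4 (l + 1)]. The
    start contributes [odd n], which is its own square. *)
Lemma binomial_half_le_gauss (R : realType) n j : (0 < n)%N ->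
  (uphalf n + j <= n)%N ->
  binomial_half R n (uphalf n + j) <= peak_scale R n *
    expR (- ((lattice_point R n (uphalf n + j) ^+ 2 - (odd n)%:R) / (2 *
        n.+1%:R))).
Proof.
move=> n0; have ps0 := ltW (peak_scale_gt0 R n n0).
have N0 : 0 < n.+1%:R :> R by rewrite ltr0n.
elim: j => [|j IH] jn.
  rewrite addn0 lattice_point_uphalf.
  have -> : (odd n)%:R ^+ 2 - (odd n)%:R = 0 :> R by case: odd; rewrite /=;
      ring.
  by rewrite mul0r oppr0 expR0 mulr1; exact: binomial_half_uphalf_le.
have jn' : (uphalf n + j < n)%N by rewrite addnS in jn.
rewrite addnS binomial_half_ratio//.
have {IH} IH := IH (ltnW jn').
have l0 : 0 <= lattice_point R n (uphalf n + j).
  by rewrite /lattice_point -natrM subr_ge0 ler_nat; lia.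
have ln : lattice_point R n (uphalf n + j) <= n%:R - 2.
  have : (uphalf n + j)%:R <= n%:R - 1 :> R.
    by rewrite lerBrDr natr1 ler_nat.
  rewrite /lattice_point; lra.
rewrite lattice_pointS.
move: (lattice_point R n (uphalf n + j)) l0 ln IH => l l0 ln IH.
set x := (l + 1) / n.+1%:R.
have x01 : 0 <= x < 1.
  rewrite /x divr_ge0 ?ltW//=; last by lra.
  by rewrite ltr_pdivrMr// mul1r -natr1; lra.
apply: le_trans (ler_pM _ _ IH (ratio_le_expR R x x01)) _.
- exact: binomial_half_ge0.
- by rewrite divr_ge0//; lra.
rewrite -mulrA -expRD ler_wpM2l// ler_expR /x.
suff -> : - ((l ^+ 2 - (odd n)%:R) / (2 * n.+1%:R)) - 2 * ((l + 1) / n.+1%:R) =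
  - (((l + 2) ^+ 2 - (odd n)%:R) / (2 * n.+1%:R)) by [].
move: (n.+1%:R : R) N0 => k k0; field; exact: lt0r_neq0.
Qed.

(** The quartic term pays for the cubes in [ratio_ge_expR]: [(l + 2) ^+ 4 - l ^+ 4 = 8 (l + 1) ^+ 3
    + 8 (l + 1)], so each step even leaves a surplus. The bound [n / 2] on the lattice point keeps
    [x <= 2^-1]. *)
Lemma binomial_half_ge_gauss (R : realType) n j : (0 < n)%N ->
  lattice_point R n (uphalf n + j) <= n%:R / 2 ->
  peak_scale R n *
    expR (- (n%:R^-1 + lattice_point R n (uphalf n + j) ^+ 2 / (2 * n.+1%:R) +
      lattice_point R n (uphalf n + j) ^+ 4 / (8 * n.+1%:R ^+ 3))) <=
  binomial_half R n (uphalf n + j).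
Proof.
move=> n0; have ps0 := ltW (peak_scale_gt0 R n n0).
have N0 : 0 < n.+1%:R :> R by rewrite ltr0n.
have n1 : 1 <= n%:R :> R by rewrite ler1n.
elim: j => [|j IH] jn.
  rewrite addn0; apply: le_trans (binomial_half_uphalf_ge R n n0).
  rewrite ler_wpM2l// ler_expR lerN2 -addrA lerDl.
  rewrite lattice_point_uphalf addr_ge0// divr_ge0 ?exprn_ge0// mulr_ge0//.
rewrite addnS lattice_pointS in jn *.
have jnp : lattice_point R n (uphalf n + j) <= n%:R / 2 by lra.
have {}IH := IH jnp.
have jn' : (uphalf n + j < n)%N.
  by rewrite -(ltr_nat R); move: jn; rewrite /lattice_point; lra.
rewrite binomial_half_ratio//.
have l0 : 0 <= lattice_point R n (uphalf n + j).
  by rewrite /lattice_point -natrM subr_ge0 ler_nat; lia.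
move: (lattice_point R n (uphalf n + j)) l0 jn {jnp} IH => l l0 jn IH.
set x := (l + 1) / n.+1%:R.
have x01 : 0 <= x <= 2^-1.
  apply/andP; split; first by rewrite divr_ge0 ?ltW//; lra.
  by rewrite /x ler_pdivrMr// -(natr1 n); lra.
apply: le_trans (ler_pM _ _ IH (ratio_ge_expR R x x01)).
- rewrite -[leRHS]mulrA -expRD ler_wpM2l// ler_expR -opprD lerN2 /x.
  rewrite -subr_ge0.
  suff -> : n%:R^-1 + (l + 2) ^+ 2 / (2 * n.+1%:R) + (l + 2) ^+ 4 / (8 *
      n.+1%:R ^+ 3) -
    (n%:R^-1 + l ^+ 2 / (2 * n.+1%:R) + l ^+ 4 / (8 * n.+1%:R ^+ 3) +
    (2 * ((l + 1) / n.+1%:R) + ((l + 1) / n.+1%:R) ^+ 3)) = (l + 1) / n.+1%:R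
        ^+ 3.
    by rewrite divr_ge0 ?exprn_ge0//; lra.
  have : n%:R != 0 :> R by rewrite pnatr_eq0 -lt0n.
  move: (n.+1%:R : R) (n%:R : R) N0 => k p k0 p0; field; rewrite ?p0 ?lt0r_neq0
      //.
- by rewrite mulr_ge0 ?expR_ge0.
- exact: expR_ge0.
Qed.

(** * The Gaussian distribution function *)

Definition gauss_cdf (R : realType) (t : R) : R :=
  fine (normal_prob 0 1 `]-oo, t]%classic).

Lemma normal_probNy (R : realType) (t : R) :
  normal_prob 0 1 `]-oo, t]%classic = (gauss_cdf R t)%:E.
Proof. by rewrite fineK// fin_num_measure. Qed.

Lemma normal_prob_y (R : realType) (t : R) :
  normal_prob 0 1 `]t, +oo[%classic = (1 - gauss_cdf R t)%:E.
Proof.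
rewrite EFinB -normal_probNy -(@probability_setC _ _ _ (normal_prob (0 : R)
    1))//.
by rewrite setCitvl.
Qed.

Lemma gauss_cdf_ge0 (R : realType) (t : R) : 0 <= gauss_cdf R t.
Proof. by rewrite fine_ge0. Qed.

Lemma gauss_cdf_le1 (R : realType) (t : R) : gauss_cdf R t <= 1.
Proof.
by rewrite -lee_fin -normal_probNy; apply: (@probability_le1 _ _ _ (normal_prob
    (0 : R) 1)).
Qed.

Lemma normal_pdf01E (R : realType) (x : R) :
  normal_pdf 0 1 x = normal_peak 1 * expR (- (x ^+ 2 / 2)).
Proof.
rewrite normal_pdfE ?oner_eq0//; congr (_ * expR _).
by rewrite subr0 expr1n mulNr.
Qed.

Lemma is_derive_gauss_cdf (R : realType) (x : R) :
  is_derive x 1 (gauss_cdf R) (normal_pdf 0 1 x).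
Proof.
(* The fundamental theorem is applied on []-oo, x + 1]], in which [x] is an interior point. *)
have x1 : x < x + 1 by lra.
have [] := @continuous_FTC1 R (normal_pdf 0 1) -oo%O x (x + 1) x1 _ _ _.
- apply: (integrableS _ _ (subsetT _)) => //; exact: integrable_normal_pdf.
- exact: ltNyr.
- by apply: continuous_normal_pdf; rewrite oner_eq0.
- by move=> d e; apply: DeriveDef => //; rewrite -derive1E.
Qed.

Lemma gauss_cdf_continuous (R : realType) : continuous (gauss_cdf R).
Proof.
move=> x; apply/differentiable_continuous/derivable1_diffP.
by have H := is_derive_gauss_cdf R x; exact: ex_derive.
Qed.

Lemma gauss_cdf_increment_le (R : realType) (a b M : R) : a <= b ->
  (forall x, a <= x <= b -> normal_pdf 0 1 x <= M) ->
  gauss_cdf R b - gauss_cdf R a <= M * (b - a).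
Proof.
move=> ab HM.
suff : M * a - gauss_cdf R a <= M * b - gauss_cdf R b by lra.
apply: (@is_derive_nondecreasing R (fun x => M * x - gauss_cdf R x)
  (fun x => M - normal_pdf 0 1 x)) => //.
- move=> x _; have H := is_derive_gauss_cdf R x.
  have H2 : is_derive x 1 (fun z : R => M * z) (M *: 1) by exact: is_deriveZ.
  by apply: is_derive_eq; rewrite scaler1.
- by move=> x /HM; rewrite subr_ge0.
Qed.

Lemma gauss_cdf_increment_ge (R : realType) (a b m : R) : a <= b ->
  (forall x, a <= x <= b -> m <= normal_pdf 0 1 x) ->
  m * (b - a) <= gauss_cdf R b - gauss_cdf R a.
Proof.
move=> ab HM.
suff : gauss_cdf R a - m * a <= gauss_cdf R b - m * b by lra.
apply: (@is_derive_nondecreasing R (fun x => gauss_cdf R x - m * x)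
  (fun x => normal_pdf 0 1 x - m)) => //.
- move=> x _; have H := is_derive_gauss_cdf R x.
  have H2 : is_derive x 1 (fun z : R => m * z) (m *: 1) by exact: is_deriveZ.
  by apply: is_derive_eq; rewrite scaler1.
- by move=> x /HM; rewrite subr_ge0.
Qed.

Lemma ler_normal_pdf01 (R : realType) (x y : R) : x ^+ 2 <= y ^+ 2 ->
  normal_pdf 0 1 y <= normal_pdf 0 1 x.
Proof.
move=> xy; rewrite !normal_pdf01E ler_wpM2l ?normal_peak_ge0// ler_expR lerN2.
by rewrite ler_pM2r ?invr_gt0.
Qed.

Lemma gauss_cdf_increasing (R : realType) : {mono gauss_cdf R : x y / x <= y}.
Proof.
apply: le_mono => a b ab.
(* All points of [[a, b]] have modulus at most [r], so the density at [r] is a positive lower bound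
   there. *)
pose r : R := `|a| + `|b|.
have : normal_pdf 0 1 r * (b - a) <= gauss_cdf R b - gauss_cdf R a.
  apply: gauss_cdf_increment_ge; first exact: ltW.
  move=> x /andP[ax xb]; apply: ler_normal_pdf01.
  rewrite -[x ^+ 2]real_normK ?num_real// ler_pXn2r// ?nnegrE//; last by
      rewrite addr_ge0.
  rewrite /r ler_norml.
  have := ler_norm b; have := ler_norm (- a); rewrite normrN.
  have := normr_ge0 a; have := normr_ge0 b; lra.
have : 0 < normal_pdf 0 1 r * (b - a).
  by rewrite mulr_gt0 ?subr_gt0// normal_pdf01E mulr_gt0 ?expR_gt0
      ?normal_peak_gt0 ?oner_eq0.
lra.
Qed.

Lemma measurable_id_real (R : realType) :
  measurable_fun [set: measurableTypeR R] (fun x : measurableTypeR R => x : R).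
Proof. exact: measurable_id. Qed.

(** Its distribution function is [gauss_cdf], which gives access to the limits at infinity; it is
    also the [Z] of the coupling. *)
Definition std_normal_id (R : realType) : {RV normal_prob (0 : R) 1 >-> R} :=
  mfun_Sub (mem_set (measurable_id_real R)).

Lemma gauss_cdf_cvgy (R : realType) : gauss_cdf R x @[x --> +oo] --> (1 : R).
Proof.
have := @cvg_cdfy1 _ _ _ (normal_prob (0 : R) 1) (std_normal_id R).
by move/fine_cvg.
Qed.

Lemma gauss_cdf_cvgNy (R : realType) : gauss_cdf R x @[x --> -oo] --> (0 : R).
Proof.
have := @cvg_cdfNy0 _ _ _ (normal_prob (0 : R) 1) (std_normal_id R).
by move/fine_cvg.
Qed.

Lemma gauss_cdf_sup (R : realType) (t M : R) :
  (forall s, t <= s -> gauss_cdf R s <= M) -> 1 <= M.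
Proof.
move=> H; rewrite leNgt; apply/negP => M1.
have [s [ts]] : exists s : R, t <= s /\ M < gauss_cdf R s.
  near (+oo : set_system R) => s; exists s; split; near: s.
    by apply: nbhs_pinfty_ge; exact: num_real.
  exact: (cvgr_gt (1 : R) (gauss_cdf_cvgy R)).
by rewrite ltNge H.
Unshelve. all: end_near. Qed.

Lemma gauss_cdf_inf (R : realType) (t m : R) :
  (forall s, s <= t -> m <= gauss_cdf R s) -> m <= 0.
Proof.
move=> H; rewrite leNgt; apply/negP => M1.
have [s [ts]] : exists s : R, s <= t /\ gauss_cdf R s < m.
  near (-oo : set_system R) => s; exists s; split; near: s.
    by apply: nbhs_ninfty_le; exact: num_real.
  exact: (cvgr_lt (0 : R) (gauss_cdf_cvgNy R)).
by rewrite ltNge H.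
Unshelve. all: end_near. Qed.

Lemma gauss_cdf_surj (R : realType) (y : R) : 0 < y < 1 ->
  exists t, gauss_cdf R t = y.
Proof.
move=> /andP[y0 y1].
have [a ay] : exists a, gauss_cdf R a < y.
  apply: contrapT => H; suff : y <= 0 by lra.
  apply: (@gauss_cdf_inf R 0) => s _; rewrite leNgt; apply/negP => ys.
  by apply: H; exists s.
have [b yb] : exists b, y < gauss_cdf R b.
  apply: contrapT => H; suff : 1 <= y by lra.
  apply: (@gauss_cdf_sup R 0) => s _; rewrite leNgt; apply/negP => ys.
  by apply: H; exists s.
have ab : a <= b by rewrite -gauss_cdf_increasing; lra.
have [||t _ <-] := @IVT R (gauss_cdf R) a b y ab.
- exact: continuous_subspaceT (gauss_cdf_continuous R).
- by rewrite minEle maxEle (ltW (lt_trans ay yb)) !ltW.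
- by exists t.
Qed.

(** The sum [f] of the values at [x] and [- x] has derivative 0, hence is nondecreasing; being even,
    it is constant. The limits at both infinities show that the constant is 1. *)
Lemma gauss_cdfN (R : realType) (t : R) : gauss_cdf R (- t) = 1 - gauss_cdf R t.
Proof.
pose f (x : R) := gauss_cdf R x + gauss_cdf R (- x).
have df (x : R) : is_derive x 1 f 0.
  have H1 := is_derive_gauss_cdf R x.
  have H2 : is_derive x 1 (fun z : R => gauss_cdf R (- z)) (normal_pdf 0 1 (-
      x) * (- 1)).
    by apply: (@is_derive1_comp R (gauss_cdf R) -%R); exact:
        is_derive_gauss_cdf.
  by apply: is_derive_eq; rewrite !normal_pdf01E sqrrN mulrN1 subrr.
have fle x y : x <= y -> f x <= f y.
  by move=> xy; apply: (@is_derive_nondecreasing R f (fun=> 0)).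
have fN x : f (- x) = f x by rewrite /f opprK addrC.
have fE x y : f x = f y.
  wlog xy : x y / x <= y.
    by move=> H; case/orP: (le_total x y) => [|/H]; [exact: H|by []].
  apply/eqP; rewrite eq_le fle//=.
  by rewrite -(fN x) -(fN y) fle// lerN2.
suff : f t = 1 by rewrite /f; lra.
apply/eqP; rewrite eq_le; apply/andP; split.
  suff : f t - 1 <= 0 by lra.
  apply: (@gauss_cdf_inf R 0) => s _.
  by rewrite (fE t s) /f; have := gauss_cdf_le1 R (- s); lra.
apply: (@gauss_cdf_sup R 0) => s _; rewrite (fE t s) /f lerDl.
exact: gauss_cdf_ge0.
Qed.

(** The sum [gauss_cdf R x + expR (- (x ^+ 2 / 2))] is nonincreasing on [x >= 1], because the peak
    of the density is at most 1, and its values beyond [t] dominate a function with limit 1. *)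
Lemma gauss_tail_le (R : realType) (t : R) : 1 <= t ->
  1 - gauss_cdf R t <= expR (- (t ^+ 2 / 2)).
Proof.
move=> t1.
have c1 : normal_peak 1 <= 1 :> R.
  rewrite -(@ler_pXn2r _ 2%N)// ?nnegrE ?normal_peak_ge0// normal_peak1_sqr
      expr1n.
  by rewrite invf_le1; have := pi_ge2 R; lra.
suff : 1 <= gauss_cdf R t + expR (- (t ^+ 2 / 2)) by lra.
apply: (@gauss_cdf_sup R t) => s ts.
apply: (@le_trans _ _ (gauss_cdf R s + expR (- (s ^+ 2 / 2)))).
  by rewrite lerDl expR_ge0.
suff : - (gauss_cdf R t + expR (- (t ^+ 2 / 2))) <= - (gauss_cdf R s + expR (-
    (s ^+ 2 / 2))) by lra.
apply: (@is_derive_nondecreasing R (fun x => - (gauss_cdf R x + expR (- (x ^+ 2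
    / 2))))
  (fun x => (x - normal_peak 1) * expR (- (x ^+ 2 / 2)))) => //.
- move=> x _; have H1 := is_derive_gauss_cdf R x.
  have Hx : is_derive x 1 (fun z : R => - (z ^+ 2 / 2)) (- x).
    have -> : (fun z : R => - (z ^+ 2 / 2)) = (fun z : R => (- 2^-1) *: z ^+ 2).
      by apply/funext => z; rewrite /GRing.scale/=; ring.
    by apply: is_derive_eq; rewrite /GRing.scale/=; field.
  have H2 : is_derive x 1 (fun z : R => expR (- (z ^+ 2 / 2))) (expR (- (x ^+ 2
      / 2)) * - x).
    exact: (@is_derive1_comp R expR (fun z => - (z ^+ 2 / 2))).
  by apply: is_derive_eq; rewrite normal_pdf01E; ring.
- by move=> x /andP[tx _]; rewrite mulr_ge0 ?expR_ge0//; lra.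
Qed.

(** * Comparison of tails *)

Lemma sqrtn_gt0 (R : realType) n : (0 < n)%N -> 0 < Num.sqrt n%:R :> R.
Proof. by move=> n0; rewrite sqrtr_gt0 ltr0n. Qed.

Lemma uphalf_le_lattice (R : realType) n i :
  0 <= lattice_point R n i -> (uphalf n <= i)%N.
Proof. by rewrite subr_ge0 -natrM ler_nat; lia. Qed.

(** The interval has length [2 / sqrt n] and lies on the nonnegative side, so its mass is at least
    that length times the density at the right end. *)
Lemma binomial_half_le_increment (R : realType) n i : (0 < n)%N -> (i <= n)%N ->
  3 <= lattice_point R n i ->
  binomial_half R n i <=
  gauss_cdf R ((lattice_point R n i - 1) / Num.sqrt n%:R) -
  gauss_cdf R ((lattice_point R n i - 3) / Num.sqrt n%:R).
Proof.
move=> n0 le_in l3.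
have ui : (uphalf n <= i)%N by apply: (uphalf_le_lattice R); lra.
have s0 := sqrtn_gt0 R n n0.
have n1 : 1 <= n%:R :> R by rewrite ler1n.
have ln : lattice_point R n i <= n%:R.
  have : i%:R <= n%:R :> R by rewrite ler_nat.
  by rewrite /lattice_point; lra.
have := @binomial_half_le_gauss R n (i - uphalf n) n0.
rewrite subnKC// => /(_ le_in); move/le_trans; apply.
move: (lattice_point R n i) l3 ln => l l3 ln.
have ab : (l - 3) / Num.sqrt n%:R <= (l - 1) / Num.sqrt n%:R.
  by rewrite ler_pM2r ?invr_gt0//; lra.
apply: le_trans (@gauss_cdf_increment_ge R _ _ (normal_pdf 0 1 ((l - 1) /
    Num.sqrt n%:R)) ab _); last first.
  move=> x /andP[x1 x2]; apply: ler_normal_pdf01.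
  have x0 : 0 <= x by apply: le_trans x1; rewrite divr_ge0 ?sqrtr_ge0//; lra.
  by rewrite ler_pXn2r// nnegrE; exact: le_trans x2.
have -> : (l - 1) / Num.sqrt n%:R - (l - 3) / Num.sqrt n%:R = 2 / Num.sqrt n%:R
    :> R.
  by rewrite -mulrBl; congr (_ / _); ring.
rewrite normal_pdf01E exprMn exprVn sqr_sqrtr ?ler0n// /peak_scale.
have -> : normal_peak 1 * expR (- ((l - 1) ^+ 2 / n%:R / 2)) * (2 / Num.sqrt
    n%:R) =
  2 * normal_peak 1 / Num.sqrt n%:R * expR (- ((l - 1) ^+ 2 / n%:R / 2)) by
      ring.
rewrite ler_wpM2l ?divr_ge0 ?mulr_ge0 ?normal_peak_ge0 ?sqrtr_ge0//.
rewrite ler_expR lerN2.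
have N0 : 0 < n.+1%:R :> R by rewrite ltr0n.
apply: (@le_trans _ _ ((l ^+ 2 - 1) / (2 * n.+1%:R))); last first.
  rewrite ler_pM2r ?invr_gt0 ?mulr_gt0// lerD2l lerN2.
  by case: odd => //=; rewrite ler01.
rewrite -mulrA -invfM ler_pdivrMr ?mulr_gt0 ?ltr0n// mulrAC ler_pdivlMr
    ?mulr_gt0//.
(* Divided by [l - 1 > 0], the claim is [l <= 2 * k + 1]. *)
rewrite -(natr1 n); move: (n%:R : R) n1 ln => k k1 ln; nra.
Qed.

(* This is [h w / sqrt n] in the notation of the header. *)
Definition stretch (R : realType) (n : nat) (w : R) : R :=
  (w + w ^+ 2 / n%:R) / Num.sqrt n%:R.

Lemma stretch_sqr (R : realType) n (w : R) :
  stretch R n w ^+ 2 / 2 = (w + w ^+ 2 * n%:R^-1) ^+ 2 * n%:R^-1 / 2.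
Proof. by rewrite /stretch exprMn exprVn sqr_sqrtr ?ler0n. Qed.

(** Here [v] stands for [1 / n]. The left side is the exponent of the binomial lower bound plus the
    term [(2 w + 2) v], [w = l + 9], caused by the length of the stretched interval; the right side
    is the Gaussian exponent at [stretch w]. The shift 9 makes every coefficient of the difference,
    as a polynomial in [v], nonnegative. *)
Lemma gauss_exponent_le (R : realType) (v l : R) : 0 <= v -> 0 <= l ->
  v + l ^+ 2 * v / 2 + l ^+ 4 * v ^+ 3 / 8 + (2 * (l + 9) + 2) * v <=
  ((l + 9) + (l + 9) ^+ 2 * v) ^+ 2 * v / 2.
Proof.
move=> v0 l0; rewrite -subr_ge0.
have -> : ((l + 9) + (l + 9) ^+ 2 * v) ^+ 2 * v / 2 -
  (v + l ^+ 2 * v / 2 + l ^+ 4 * v ^+ 3 / 8 + (2 * (l + 9) + 2) * v) =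
  v * (7 * l + 39 / 2) + v ^+ 2 * (l + 9) ^+ 3 + v ^+ 3 * (((l + 9) ^+ 4 - l ^+
      4) / 2 + l ^+ 4 * (3 / 8)) by field.
have l4 : l ^+ 4 <= (l + 9) ^+ 4 by rewrite ler_pXn2r ?nnegrE//; lra.
have l40 : 0 <= l ^+ 4 by exact: exprn_ge0.
by rewrite !addr_ge0 ?mulr_ge0 ?exprn_ge0//; lra.
Qed.

Lemma binomial_half_ge_simple (R : realType) n i : (0 < n)%N ->
  0 <= lattice_point R n i <= n%:R / 2 ->
  peak_scale R n * expR (- (n%:R^-1 + lattice_point R n i ^+ 2 * n%:R^-1 / 2 +
    lattice_point R n i ^+ 4 * n%:R^-1 ^+ 3 / 8)) <= binomial_half R n i.
Proof.
move=> n0 /andP[l0 ln].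
have ui := uphalf_le_lattice R n i l0.
have := @binomial_half_ge_gauss R n (i - uphalf n) n0.
rewrite subnKC// => /(_ ln); apply: le_trans.
move: (lattice_point R n i) l0 => l l0.
rewrite ler_wpM2l ?(ltW (peak_scale_gt0 _ _ _))// ler_expR lerN2.
have nR : 0 < n%:R :> R by rewrite ltr0n.
have N0 : 0 < n.+1%:R :> R by rewrite ltr0n.
have le : n.+1%:R^-1 <= n%:R^-1 :> R by rewrite lef_pV2 ?posrE// ler_nat.
have le3 : n.+1%:R^-1 ^+ 3 <= n%:R^-1 ^+ 3 :> R.
  by rewrite ler_pXn2r ?nnegrE ?invr_ge0 ?ler0n.
have -> : l ^+ 2 / (2 * n.+1%:R) = l ^+ 2 * n.+1%:R^-1 / 2 by rewrite invfM;
    ring.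
have -> : l ^+ 4 / (8 * n.+1%:R ^+ 3) = l ^+ 4 * n.+1%:R^-1 ^+ 3 / 8.
  by rewrite invfM exprVn; ring.
by rewrite !lerD// ler_pM2r ?invr_gt0// ler_wpM2l ?exprn_ge0.
Qed.

Lemma stretch_ge0 (R : realType) n (w : R) : 0 <= w -> 0 <= stretch R n w.
Proof. by move=> w0; rewrite divr_ge0 ?sqrtr_ge0// addr_ge0// divr_ge0//
    exprn_ge0. Qed.

(** The mass is at most the density at the left end times the length. The length exceeds
    [2 / sqrt n] by the factor [1 + (2 w + 2) / n], which is moved into the exponent by
    [1 + u <= expR u]. *)
Lemma binomial_half_ge_increment (R : realType) n i : (0 < n)%N ->
  0 <= lattice_point R n i <= n%:R / 2 ->
  gauss_cdf R (stretch R n (lattice_point R n i + 11)) -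
  gauss_cdf R (stretch R n (lattice_point R n i + 9)) <= binomial_half R n i.
Proof.
move=> n0 lb; apply: le_trans (binomial_half_ge_simple R n i n0 lb).
have /andP[l0 ln] := lb.
move: (lattice_point R n i) l0 {lb ln} => l l0.
have nR : 0 < n%:R :> R by rewrite ltr0n.
have v0 : 0 < n%:R^-1 :> R by rewrite invr_gt0.
have s0 := sqrtn_gt0 R n n0.
set w := l + 9.
have -> : l + 11 = w + 2 by rewrite /w; ring.
have D : stretch R n (w + 2) - stretch R n w = 2 / Num.sqrt n%:R * (1 + (2 * w
    + 2) * n%:R^-1).
  by rewrite /stretch; ring.
have w0 : 0 <= w by rewrite /w; lra.
have wv : 0 <= (2 * w + 2) * n%:R^-1 by rewrite mulr_ge0//; lra.
have ab : stretch R n w <= stretch R n (w + 2).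
  by rewrite -subr_ge0 D mulr_ge0 ?divr_ge0 ?sqrtr_ge0//; lra.
apply: le_trans (@gauss_cdf_increment_le R _ _ (normal_pdf 0 1 (stretch R n w))
    ab _) _.
  move=> x /andP[x1 _]; apply: ler_normal_pdf01.
  have := stretch_ge0 R n w w0; nra.
rewrite D normal_pdf01E stretch_sqr.
apply: (@le_trans _ _ (peak_scale R n * (expR (- ((w + w ^+ 2 * n%:R^-1) ^+ 2 *
    n%:R^-1 / 2)) * expR ((2 * w + 2) * n%:R^-1)))).
  have -> : normal_peak 1 * expR (- ((w + w ^+ 2 * n%:R^-1) ^+ 2 * n%:R^-1 /
      2)) *
    (2 / Num.sqrt n%:R * (1 + (2 * w + 2) * n%:R^-1)) =
    peak_scale R n * (expR (- ((w + w ^+ 2 * n%:R^-1) ^+ 2 * n%:R^-1 / 2)) *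
     (1 + (2 * w + 2) * n%:R^-1)) by rewrite /peak_scale; ring.
  rewrite ler_wpM2l ?(ltW (peak_scale_gt0 _ _ _))// ler_wpM2l ?expR_ge0//.
  exact: expR_ge1Dx.
rewrite ler_wpM2l ?(ltW (peak_scale_gt0 _ _ _))// -expRD ler_expR.
have := gauss_exponent_le R _ _ (ltW v0) l0; rewrite -/w; lra.
Qed.

(** Starting point for summing the local bounds, which stop at [n / 2]: there a single binomial
    weight already exceeds the whole Gaussian tail. The cubic term of the stretched exponent gains
    [expR (n / 8)], against a [peak_scale] of order [1 / sqrt n]. *)
Lemma gauss_tail_le_binomial_half (R : realType) n i : (200 <= n)%N ->
  n%:R / 2 - 2 <= lattice_point R n i <= n%:R / 2 ->
  1 - gauss_cdf R (stretch R n (lattice_point R n i + 9)) <= binomial_half R n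
      i.
Proof.
move=> n200 /andP[l0 ln].
have n0 : (0 < n)%N by lia.
have nR : 200 <= n%:R :> R by rewrite ler_nat.
have lb : 0 <= lattice_point R n i <= n%:R / 2 by rewrite ln andbT; lra.
apply: le_trans (binomial_half_ge_simple R n i n0 lb).
move: (lattice_point R n i) l0 ln {lb} => l ln1 ln2.
have v0 : 0 < n%:R^-1 :> R by rewrite invr_gt0; lra.
have nv : n%:R * n%:R^-1 = 1 :> R by rewrite divff// lt0r_neq0//; lra.
have v1 : n%:R^-1 <= 1 :> R by rewrite invf_le1; lra.
have ps0 := peak_scale_gt0 R n n0.
have s0 := sqrtn_gt0 R n n0.
have w0 : 0 <= l + 9 by lra.
apply: le_trans (@gauss_tail_le R _ _) _.
  rewrite /stretch ler_pdivlMr// mul1r.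
  apply: (@le_trans _ _ (n%:R / 2)).
    rewrite -(@ler_pXn2r _ 2%N)// ?nnegrE ?sqrtr_ge0//.
    rewrite sqr_sqrtr ?ler0n//; nra.
  have : 0 <= (l + 9) ^+ 2 / n%:R by rewrite divr_ge0 ?exprn_ge0.
  lra.
rewrite stretch_sqr.
(* Squared, and with [pi <= 4], this follows from [(n / 8 - 1) ^+ 2 >= 2 n], which [200 <= n]
   guarantees. *)
have k1 : 1 <= peak_scale R n * (n%:R / 8 - 1).
  rewrite -(@ler_pXn2r _ 2%N)// ?nnegrE//; last by rewrite mulr_ge0 ?ltW//; lra.
  rewrite expr1n exprMn peak_scale_sqr// mulrAC ler_pdivlMr; last first.
    by rewrite mulr_gt0 ?pi_gt0//; lra.
  have pn : pi * n%:R <= 4 * n%:R :> R.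
    by rewrite ler_wpM2r//; have := pihalf_lt2 R; lra.
  have q : 2 * n%:R <= (n%:R / 8 - 1) ^+ 2 :> R by nra.
  lra.
have e1 : n%:R / 8 - 1 <= expR (n%:R / 8 - n%:R^-1) :> R.
  by apply: le_trans (expR_ge1Dx _); lra.
have k2 : 1 <= peak_scale R n * expR (n%:R / 8 - n%:R^-1).
  by apply: le_trans k1 _; rewrite ler_pM2l.
apply: (@le_trans _ _ (peak_scale R n * expR (n%:R / 8 - n%:R^-1) *
   expR (- (((l + 9) + (l + 9) ^+ 2 * n%:R^-1) ^+ 2 * n%:R^-1 / 2)))).
  by rewrite ler_peMl// expR_ge0.
rewrite -mulrA ler_pM2l// -expRD ler_expR.
have c3 : n%:R / 8 <= (l + 9) ^+ 3 * n%:R^-1 ^+ 2.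
  have -> : n%:R / 8 = (n%:R / 2) ^+ 3 * n%:R^-1 ^+ 2 :> R.
    by field; apply: lt0r_neq0; lra.
  by rewrite ler_pM2r ?exprn_gt0// ler_pXn2r ?nnegrE//; lra.
have l4 : l ^+ 4 <= (l + 9) ^+ 4 by rewrite ler_pXn2r ?nnegrE//; lra.
have l2 : l ^+ 2 * n%:R^-1 <= (l + 9) ^+ 2 * n%:R^-1.
  by rewrite ler_pM2r// ler_pXn2r ?nnegrE//; lra.
have l40 : 0 <= l ^+ 4 by rewrite exprn_ge0//; lra.
have l4v : l ^+ 4 * n%:R^-1 ^+ 3 / 8 <= (l + 9) ^+ 4 * n%:R^-1 ^+ 3 / 2.
  have v3 : 0 <= n%:R^-1 ^+ 3 :> R by rewrite exprn_ge0// ltW.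
  have := ler_wpM2r v3 l4; have := mulr_ge0 l40 v3; lra.
have -> : ((l + 9) + (l + 9) ^+ 2 * n%:R^-1) ^+ 2 * n%:R^-1 / 2 =
  (l + 9) ^+ 2 * n%:R^-1 / 2 + (l + 9) ^+ 3 * n%:R^-1 ^+ 2 + (l + 9) ^+ 4 *
      n%:R^-1 ^+ 3 / 2.
  by field; apply: lt0r_neq0; lra.
lra.
Qed.

Definition binomial_tail (R : realType) (n i : nat) : R :=
  \sum_(i <= j < n.+1) binomial_half R n j.

Lemma binomial_tailS (R : realType) n i : (i <= n)%N ->
  binomial_tail R n i = binomial_half R n i + binomial_tail R n i.+1.
Proof. by move=> le_in; rewrite /binomial_tail big_ltn. Qed.

(** The Gaussian intervals of consecutive lattice points are adjacent, so the local bounds add up;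
    the descending induction starts beyond [n] with an empty tail. *)
Lemma binomial_tail_le (R : realType) n i : (0 < n)%N ->
  3 <= lattice_point R n i ->
  binomial_tail R n i <=
  1 - gauss_cdf R ((lattice_point R n i - 3) / Num.sqrt n%:R).
Proof.
move=> n0; have [m] := ubnP (n.+1 - i); elim: m i => // m IH i im l3.
have [le_in|lt_ni] := leqP i n; last first.
  by rewrite /binomial_tail big_geq// subr_ge0 gauss_cdf_le1.
rewrite binomial_tailS//.
have := IH i.+1; rewrite lattice_pointS => /(_ _ _)/le_trans H.
have {}H : binomial_tail R n i.+1 <= 1 - gauss_cdf R ((lattice_point R n i + 2
    - 3) / Num.sqrt n%:R).
  by apply: H; [lia | lra | exact: lexx].
have := binomial_half_le_increment R n i n0 le_in l3.
move: H; have -> : lattice_point R n i + 2 - 3 = lattice_point R n i - 1 by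
    ring.
lra.
Qed.

Lemma binomial_tail_ge0 (R : realType) n i : 0 <= binomial_tail R n i.
Proof. by rewrite sumr_ge0// => j _; exact: binomial_half_ge0. Qed.

(** Descending induction from the last lattice point up to [n / 2], where
    [gauss_tail_le_binomial_half] bounds the entire remaining tail. *)
Lemma binomial_tail_ge (R : realType) n i : (200 <= n)%N ->
  0 <= lattice_point R n i <= n%:R / 2 ->
  1 - gauss_cdf R (stretch R n (lattice_point R n i + 9)) <= binomial_tail R n
      i.
Proof.
move=> n200; have n0 : (0 < n)%N by lia.
have nR : 200 <= n%:R :> R by rewrite ler_nat.
have [m] := ubnP (n.+1 - i); elim: m i => // m IH i im /andP[l0 ln].
have le_in : (i <= n)%N by rewrite -(ler_nat R); move: ln; rewrite
    /lattice_point; lra.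
rewrite binomial_tailS//.
have [big|small] := lerP (n%:R / 2 - 2) (lattice_point R n i).
  have := @gauss_tail_le_binomial_half R n i n200; rewrite big ln => /(_ isT).
  by have := binomial_tail_ge0 R n i.+1; lra.
have := IH i.+1; rewrite lattice_pointS => /(_ _ _) H.
have {}H : 1 - gauss_cdf R (stretch R n (lattice_point R n i + 2 + 9)) <=
    binomial_tail R n i.+1.
  by apply: H; [lia | apply/andP; split; lra].
have := @binomial_half_ge_increment R n i n0; rewrite l0 ln => /(_ isT).
move: H; have -> : lattice_point R n i + 2 + 9 = lattice_point R n i + 11 by
    ring.
lra.
Qed.

(** * Quantile thresholds *)

Lemma binomial_tail0 (R : realType) n : binomial_tail R n 0 = 1.
Proof. exact: sum_binomial_half. Qed.

Lemma binomial_tail_geq (R : realType) n i : (n < i)%N -> binomial_tail R n i =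
    0.
Proof. by move=> ni; rewrite /binomial_tail big_geq. Qed.

Lemma binomial_tail_decreasing (R : realType) n i j : (i < j)%N -> (j <=
    n.+1)%N ->
  binomial_tail R n j < binomial_tail R n i.
Proof.
move=> ij; elim: j ij => // j IH; rewrite ltnS leq_eqVlt => /orP[/eqP ->|ij] jn.
  by rewrite (binomial_tailS R n j)// ltrDr binomial_half_gt0.
apply: lt_trans (IH ij (ltnW jn)).
by rewrite (binomial_tailS R n j)// ltrDr binomial_half_gt0.
Qed.

Lemma binomial_tail_sym (R : realType) n i : (i <= n.+1)%N ->
  binomial_tail R n (n.+1 - i) = 1 - binomial_tail R n i.
Proof.
elim: i => [|i IH] le_in.
  by rewrite subn0 binomial_tail_geq// binomial_tail0 subrr.
rewrite subSS binomial_tailS ?leq_subr// binomial_half_sub// -subSn//.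
by rewrite (IH (ltnW le_in)) (binomial_tailS R n i)//; ring.
Qed.

(** Only the indices 1 to [n] are constrained: the thresholds of index 0 and [n + 1] would be [-oo]
    and [+oo]. *)
Definition quantile_thresholds (R : realType) (n : nat) (t : nat -> R) : Prop :=
  forall i, (0 < i <= n)%N -> gauss_cdf R (t i) = 1 - binomial_tail R n i.

Lemma quantile_thresholds_exist (R : realType) n :
  exists t, quantile_thresholds R n t.
Proof.
suff H i : exists t, (0 < i <= n)%N -> gauss_cdf R t = 1 - binomial_tail R n i.
  by have [t Ht] := choice H; exists t.
have [/andP[i0 le_in]|_] := boolP (0 < i <= n)%N; last by exists 0.
have [|t Ht] := @gauss_cdf_surj R (1 - binomial_tail R n i); last by exists t.
have := @binomial_tail_decreasing R n 0 i i0 (leqW le_in).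
have := @binomial_tail_decreasing R n i n.+1 le_in (leqnn _).
by rewrite binomial_tail0 (binomial_tail_geq R n n.+1)//; lra.
Qed.

Lemma lattice_point_sub (R : realType) n i : (i <= n)%N ->
  lattice_point R n (n - i) = - lattice_point R n i.
Proof. by move=> le_in; rewrite /lattice_point natrB//; ring. Qed.

Section thresholds.
Context (R : realType) (n : nat) (t : nat -> R).
Context (tP : quantile_thresholds R n t).

Lemma threshold_lt i j : (0 < i)%N -> (i < j)%N -> (j <= n)%N -> t i < t j.
Proof.
move=> i0 ij jn; rewrite ltNge -gauss_cdf_increasing -ltNge.
have ib : (0 < i <= n)%N by lia.
have jb : (0 < j <= n)%N by lia.
by rewrite (tP i ib) (tP j jb) ltrD2l ltrN2 binomial_tail_decreasing// leqW.
Qed.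

Lemma threshold_le i j : (0 < i)%N -> (i <= j)%N -> (j <= n)%N -> t i <= t j.
Proof.
by move=> i0; rewrite leq_eqVlt => /orP[/eqP ->//|ij] jn;
    exact/ltW/threshold_lt.
Qed.

(** Both laws are symmetric and [gauss_cdf] is injective. *)
Lemma thresholdN i : (0 < i <= n)%N -> t (n.+1 - i)%N = - t i.
Proof.
move=> /andP[i0 le_in]; apply: (inc_inj (gauss_cdf_increasing R)).
have jb : (0 < n.+1 - i <= n)%N by lia.
by rewrite gauss_cdfN (tP _ jb) tP ?i0// binomial_tail_sym ?leqW.
Qed.

Lemma threshold_ge i : (0 < i <= n)%N -> 3 <= lattice_point R n i ->
  lattice_point R n i - 3 <= t i * Num.sqrt n%:R.
Proof.
move=> ib l3; have n0 : (0 < n)%N by lia.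
rewrite -ler_pdivrMr ?sqrtn_gt0// -gauss_cdf_increasing tP//.
by have := binomial_tail_le R n i n0 l3; lra.
Qed.

Lemma threshold_le_stretch i : (200 <= n)%N -> (0 < i <= n)%N ->
  0 <= lattice_point R n i <= n%:R / 2 ->
  t i <= stretch R n (lattice_point R n i + 9).
Proof.
move=> n200 ib lb; rewrite -gauss_cdf_increasing tP//.
by have := binomial_tail_ge R n i n200 lb; lra.
Qed.

(** The two conditions say that [z] lies in the cell of index [i]. They are both non-strict, so that
    they survive the reflection [z] to [- z] in [quantile_bounds]. *)
Lemma quantile_bounds_ge0 (z : R) i : (200 <= n)%N -> 0 <= z -> (i <= n)%N ->
  ((0 < i)%N -> t i <= z) -> ((i < n)%N -> z <= t i.+1) ->
  `|lattice_point R n i| <= z * Num.sqrt n%:R + 3 /\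
  `|lattice_point R n i - z * Num.sqrt n%:R| <= z ^+ 2 + 11.
Proof.
move=> n200 z0 le_in tz zt.
have n0 : (0 < n)%N by lia.
have s0 := sqrtn_gt0 R n n0.
have nR : 200 <= n%:R :> R by rewrite ler_nat.
have s2 : Num.sqrt n%:R ^+ 2 = n%:R :> R by rewrite sqr_sqrtr.
have zs : 0 <= z * Num.sqrt n%:R by rewrite mulr_ge0// ltW.
(* A lattice point below [-1] would make [t i.+1] negative by symmetry, contrary to
   [0 <= z <= t i.+1]. *)
have lN1 : -1 <= lattice_point R n i.
  have [lt_in|ge_in] := ltnP i n; last first.
    have -> : i = n by lia.
    rewrite /lattice_point; lra.
  have : (n <= i.*2.+1)%N.
    rewrite leqNgt; apply/negP => H.
    have i1n : (0 < i.+1 <= n)%N by lia.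
    have E := thresholdN i.+1 i1n.
    have : t i.+1 < - t i.+1 by rewrite -E; apply: threshold_lt; lia.
    by have := zt lt_in; lra.
  by rewrite -(ler_nat R) -natr1 -mul2n natrM /lattice_point; lra.
have upper : lattice_point R n i <= z * Num.sqrt n%:R + 3.
  have [l3|] := lerP 3 (lattice_point R n i); last by lra.
  have i0 : (0 < i)%N.
    rewrite lt0n; apply/eqP => i0; move: l3; rewrite i0 /lattice_point; lra.
  have ib : (0 < i <= n)%N by rewrite i0.
  have := threshold_ge i ib l3.
  have := ler_wpM2r (ltW s0) (tz i0); lra.
have lower : z * Num.sqrt n%:R - lattice_point R n i <= z ^+ 2 + 11.
  have [big|small] := lerP (n%:R / 4) (lattice_point R n i + 11).
    (* Expanding the square gives [z sqrt n - z ^+ 2 <= n / 4]. *)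
    have : 0 <= (z - Num.sqrt n%:R / 2) ^+ 2 by rewrite sqr_ge0.
    move: s2 big; move: (Num.sqrt n%:R) => s s2 big; rewrite -s2 in big *; nra.
  have lt_in : (i < n)%N.
    by rewrite -(ltr_nat R); move: small; rewrite /lattice_point; lra.
  (* The right end of the cell is the threshold of the next lattice point, so the shift 9 becomes
     11. *)
  have := @threshold_le_stretch i.+1 n200; rewrite lattice_pointS.
  have -> : lattice_point R n i + 2 + 9 = lattice_point R n i + 11 by ring.
  have ib : (0 < i.+1 <= n)%N by [].
  have lb : 0 <= lattice_point R n i + 2 <= n%:R / 2 by apply/andP; split; lra.
  move=> /(_ ib lb) tw; have {}tw := le_trans (zt lt_in) tw.
  move: tw; rewrite /stretch ler_pdivlMr//.
  move: (lattice_point R n i) lN1 small {upper lb} => l lN1 small.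
  rewrite leNgt => zw; rewrite leNgt; apply/negP => H.
  have w0 : 0 < l + 11 by lra.
  have z2 : 0 <= z ^+ 2 by exact: sqr_ge0.
  have zsw : l + 11 < z * Num.sqrt n%:R by lra.
  have : z ^+ 2 < (l + 11) ^+ 2 / n%:R by rewrite -leNgt in zw; lra.
  rewrite ltr_pdivlMr; last by lra.
  rewrite -s2 -exprMn ltr_pXn2r ?nnegrE//; lra.
have z2 : 0 <= z ^+ 2 by exact: sqr_ge0.
(* The sides other than [upper] and [lower] come from [lN1] and from [upper] again, as
   [3 <= z ^+ 2 + 11]. *)
split; first by rewrite ler_norml; apply/andP; split; lra.
by rewrite ler_norml; apply/andP; split; lra.
Qed.

Lemma quantile_bounds (z : R) i : (200 <= n)%N -> (i <= n)%N ->
  ((0 < i)%N -> t i <= z) -> ((i < n)%N -> z <= t i.+1) ->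
  `|lattice_point R n i| <= `|z| * Num.sqrt n%:R + 3 /\
  `|lattice_point R n i - z * Num.sqrt n%:R| <= z ^+ 2 + 11.
Proof.
move=> n200 le_in tz zt; have [z0|z0] := lerP 0 z.
  by rewrite (ger0_norm z0); exact: quantile_bounds_ge0.
have Nz0 : 0 <= - z by lra.
have := @quantile_bounds_ge0 (- z) (n - i) n200 Nz0 (leq_subr _ _).
rewrite (ltr0_norm z0) lattice_point_sub// normrN [X in - _ - X]mulNr -opprD
    normrN sqrrN; apply.
- move=> ni; have lt_in : (i < n)%N by lia.
  have := thresholdN i.+1; rewrite subSS => ->; last by lia.
  by rewrite lerN2; exact: zt.
- move=> ni; have i0 : (0 < i)%N by lia.
  rewrite -subSn// thresholdN ?i0// lerN2; exact: tz.
Qed.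

End thresholds.

(** * Laws with finite support *)

Section finite_law.
Context (R : realType) (d : measure_display) (T : measurableType d)
  (P : probability T R) (Y : {RV P >-> R}).
Context (I : finType) (E : I -> set T) (p v : I -> R).
Context (mE : forall i, measurable (E i)).
Context (tE : trivIset setT E).
Context (PE : forall i, P (E i) = (p i)%:E).
Context (YE : forall i w, E i w -> Y w = v i).

Lemma finite_law_ge (A : set R) : measurable A ->
  ((\sum_(i | v i \in A) p i)%:E <= distribution P Y A)%E.
Proof.
move=> mA; pose D := [set` [pred i | v i \in A]].
have -> : (\sum_(i | v i \in A) p i)%:E = P (\bigcup_(i in D) E i).
  rewrite measure_fin_bigcup//; last exact: sub_trivIset tE.
  rewrite -sumEFin (@bigfs _ _ _ _ (index_enum I))//; last first.
  - by move=> i _; rewrite mem_index_enum.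
  - exact: index_enum_uniq.
  - by apply: eq_fsbigr => i _; exact/esym/PE.
  - exact: finite_finpred.
apply: le_measure; rewrite ?inE.
- by apply: fin_bigcup_measurable.
- by rewrite -[X in measurable X]setTI; exact: measurable_funP.
- move=> w [i /=]; rewrite /D /= inE => vA Eiw.
  by rewrite /preimage/= (YE _ _ Eiw).
Qed.

(** The lower bounds for [A] and for its complement add up to 1, so both are equalities. This takes
    care of the null set outside the events [E i]. *)
Lemma finite_law (A : set R) : \sum_i p i = 1 -> measurable A ->
  distribution P Y A = (\sum_(i | v i \in A) p i)%:E.
Proof.
move=> p1 mA.
have := finite_law_ge A mA.
have := finite_law_ge (~` A) (measurableC mA).
set a := fine (distribution P Y A).
have aE : distribution P Y A = a%:E by rewrite /a fineK// fin_num_measure.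
have -> : distribution P Y (~` A) = (1 - a)%:E.
  by rewrite (@probability_setC _ _ _ (distribution P Y))// EFinB; congr (_ -
      _)%E.
have -> : (\sum_(i | v i \in ~` A) p i) = 1 - \sum_(i | v i \in A) p i.
  rewrite -p1 [in RHS](bigID (fun i => v i \in A)) /= addrAC subrr add0r.
  by apply: eq_bigl => i; rewrite in_setC.
rewrite aE !lee_fin => H1 H2.
by congr EFin; apply/eqP; rewrite eq_le; apply/andP; split; lra.
Qed.

End finite_law.

(** * The law of the partial sums *)

Section sign_vectors.
Context (R : realType) (d : measure_display) (T : measurableType d)
  (P : probability T R) (X : nat -> {RV P >-> R}).
Context (iidX : iid_symmetric_bernoulli X).

(* The value 1 off ['I_n] is never used. *)
Definition sign_of (n : nat) (e : {set 'I_n}) (j : nat) : R :=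
  if insub j is Some i then (if i \in e then 1 else -1) else 1.

Lemma sign_of_ord n (e : {set 'I_n}) (i : 'I_n) :
  sign_of n e i = if i \in e then 1 else -1.
Proof. by rewrite /sign_of valK. Qed.

(** A sign vector is encoded by the set [e] of its [+1] positions; the intersection has the shape
    required by [mutually_independent]. *)
Definition sign_event (n : nat) (e : {set 'I_n}) : set T :=
  \bigcap_(j in [set` [fset j in iota 0 n]%fset]) (X j @^-1` [set sign_of n e
      j]).

Lemma sign_eventP n (e : {set 'I_n}) w : sign_event n e w ->
  forall i : 'I_n, X i w = if i \in e then 1 else -1.
Proof.
move=> Ew i; rewrite -sign_of_ord; apply: (Ew i).
by rewrite /= !inE mem_iota /=.
Qed.

Lemma measurable_sign_event n (e : {set 'I_n}) : measurable (sign_event n e).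
Proof.
exact: fin_bigcap_measurable.
Qed.

Lemma trivIset_sign_event n : trivIset setT (sign_event n).
Proof.
move=> e f _ _ [w [/sign_eventP Ew /sign_eventP Fw]].
apply/setP => i; have := Ew i; rewrite Fw.
by do 2 case: ifP => // _; move=> H; exfalso; lra.
Qed.

Lemma probability_sign_event n (e : {set 'I_n}) :
  P (sign_event n e) = (2 ^- n)%:E.
Proof.
rewrite /sign_event iidX.1; last by move=> i; exact: measurable_set1.
rewrite (eq_bigr (fun=> (2^-1)%:E)); last first.
  move=> j _; have [P1 PN1] := iidX.2 j.
  by rewrite /sign_of; case: insubP => [i _ _|_]; [case: ifP => _|].
rewrite prodEFin; congr EFin.
rewrite big_const_seq count_predT iter_mulr_1 exprVn.
suff -> : size [fset j in iota 0 n]%fset = n by [].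
by rewrite card_fseq undup_id ?iota_uniq// size_iota.
Qed.

Lemma partial_sumE n w : partial_sum X n w = \sum_(i < n) X i w.
Proof.
rewrite /partial_sum.
by apply: (big_morph (fun f : {mfun T >-> R} => f w)).
Qed.

Lemma partial_sum_sign_event n (e : {set 'I_n}) w : sign_event n e w ->
  partial_sum X n w = lattice_point R n #|e|.
Proof.
move=> /sign_eventP Ew; rewrite partial_sumE (eq_bigr _ (fun i _ => Ew i)).
have -> : \sum_(i < n) (if i \in e then 1 else -1) = \sum_(i < n) (2 * (i \in
    e)%:R - 1) :> R.
  by apply: eq_bigr => i _; case: ifP => _; rewrite ?mulr1 ?mulr0; lra.
rewrite sumrB -mulr_sumr sumr_const card_ord /lattice_point; congr (2 * _ - _).
by rewrite -natr_sum -big_mkcond /= sum1_card.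
Qed.

(** The sign vectors, each of probability [2 ^- n], are grouped by their number [k] of [+1] entries,
    and ['C(n, k)] of them fall in each group. *)
Lemma partial_sum_law n (A : set R) : measurable A ->
  distribution P (partial_sum X n) A =
  (\sum_(k < n.+1 | lattice_point R n k \in A) binomial_half R n k)%:E.
Proof.
move=> mA.
rewrite (@finite_law R d T P (partial_sum X n) {set 'I_n} (sign_event n)
  (fun=> 2 ^- n) (fun e => lattice_point R n #|e|)) //; first last.
- rewrite sumr_const -cardsT -powersetT card_powerset cardsT card_ord.
  by rewrite -[LHS]mulr_natr natrX mulVf// expf_neq0.
- exact: partial_sum_sign_event.
- exact: probability_sign_event.
- exact: trivIset_sign_event.
- exact: measurable_sign_event.
congr EFin.
have ce (e : {set 'I_n}) : (#|e| < n.+1)%N.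
  by rewrite ltnS -[leqRHS](card_ord n) max_card.
rewrite (partition_big (fun e : {set 'I_n} => Ordinal (ce e))
  (fun k : 'I_n.+1 => lattice_point R n k \in A)) //=.
apply: eq_bigr => k kA.
rewrite (eq_bigl (fun e => e \in [set e : {set 'I_n} | #|e| == k]%SET)); last
    first.
  move=> e; rewrite inE -val_eqE /=; case: eqP => [->|_]; rewrite ?andbF ?kA //.
by rewrite sumr_const card_draws card_ord /binomial_half mulr_natl.
Qed.

End sign_vectors.

(** * The quantile coupling *)

(** Counting the thresholds below [z] makes the index a sum of indicators of rays, from which
    measurability follows. *)
Definition quantile_index (R : realType) (n : nat) (t : nat -> R) (z : R) : nat
    :=
  (\sum_(j < n) (t j.+1 < z)%R)%N.

Lemma threshold_cell_exists (R : realType) (t : nat -> R) (z : R) n :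
  exists i, [/\ (i <= n)%N, (0 < i)%N -> t i < z & (i < n)%N -> z <= t i.+1].
Proof.
elim: n => [|n [i [le_in ti ti1]]]; first by exists 0%N.
have [zn|nz] := ltP (t n.+1) z; first by exists n.+1; split; rewrite ?ltnn.
exists i; split => //; first exact: leqW.
rewrite ltnS leq_eqVlt => /orP[/eqP ->//|]; exact: ti1.
Qed.

Section quantile_coupling.
Context (R : realType) (n : nat) (t : nat -> R).
Context (tP : quantile_thresholds R n t).

Lemma quantile_indexE (z : R) i : (i <= n)%N ->
  ((0 < i)%N -> t i < z) -> ((i < n)%N -> z <= t i.+1) ->
  quantile_index R n t z = i.
Proof.
move=> le_in ti ti1; rewrite /quantile_index -(big_mkord xpredT (fun j => (t
    j.+1 < z)%R : nat)).
have lo : (\sum_(0 <= j < i) (t j.+1 < z)%R = i)%N.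
  rewrite (eq_big_nat _ _ (F2 := fun=> 1%N)) => [|j /andP[_ ji]].
    by rewrite sum_nat_const_nat subn0 muln1.
  rewrite (le_lt_trans _ (ti (leq_ltn_trans (leq0n j) ji)))//.
  exact: (threshold_le R n t tP).
have hi : (\sum_(i <= j < n) (t j.+1 < z)%R = 0)%N.
  rewrite (eq_big_nat _ _ (F2 := fun=> 0%N)) => [|j /andP[ij jn]].
    by rewrite sum_nat_const_nat muln0.
  rewrite ltNge (le_trans (ti1 (leq_ltn_trans ij jn)))//.
  exact: (threshold_le R n t tP).
by rewrite (@big_cat_nat _ _ _ i)//= lo hi addn0.
Qed.

(** The event that the quantile index is at least [i]; the two extra cases play the part of infinite
    thresholds at 0 and beyond [n]. *)
Definition upper_ray (i : nat) : set (measurableTypeR R) :=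
  if i == 0%N then setT else if (i <= n)%N then `]t i, +oo[%classic else set0.

Lemma measurable_upper_ray i : measurable (upper_ray i).
Proof. by rewrite /upper_ray; case: ifP => // _; case: ifP => // _; exact:
    measurable_itv. Qed.

Lemma upper_rayS i : upper_ray i.+1 `<=` upper_ray i.
Proof.
rewrite /upper_ray /=; case: eqP => [_ //|/eqP i0].
have [lt_in|_] := ltnP i n; last exact: sub0set.
rewrite (ltnW lt_in) => z /=.
rewrite !in_itv /= !andbT; apply: le_lt_trans; apply: (threshold_le R n t tP)
    => //.
by rewrite lt0n.
Qed.

Lemma probability_upper_ray i : (i <= n.+1)%N ->
  normal_prob 0 1 (upper_ray i) = (binomial_tail R n i)%:E.
Proof.
move=> iS; rewrite /upper_ray; case: eqP => [->|/eqP i0].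
  by rewrite binomial_tail0; apply: (@probability_setT _ _ _ (normal_prob (0 :
      R) 1)).
have [le_in|lt_ni] := leqP i n.
  by rewrite normal_prob_y tP ?lt0n ?i0//; congr EFin; ring.
by rewrite binomial_tail_geq// measure0.
Qed.

Definition quantile_cell (i : 'I_n.+1) := upper_ray i `\` upper_ray i.+1.

Lemma quantile_cellP i z : quantile_cell i z -> quantile_index R n t z = i.
Proof.
move=> [z1 z2]; apply: quantile_indexE; first by rewrite -ltnS.
- move=> i0; move: z1; rewrite /upper_ray gtn_eqF// -ltnS ltn_ord /=.
  by rewrite in_itv/= andbT.
- move=> lt_in; move: z2; rewrite /upper_ray /= lt_in /= in_itv/= andbT.
  by move/negP; rewrite -leNgt.
Qed.

Lemma probability_quantile_cell i :
  normal_prob 0 1 (quantile_cell i) = (binomial_half R n i)%:E.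
Proof.
have mr := measurable_upper_ray.
transitivity (normal_prob 0 1 (upper_ray i) -
    normal_prob 0 1 (upper_ray i `&` upper_ray i.+1))%E.
  apply: (@measureD _ _ _ (normal_prob (0 : R) 1)) => //.
  by apply: le_lt_trans (probability_le1 _ (mr i)) _; exact: ltry.
rewrite setIidr; last exact: upper_rayS.
have iS := ltn_ord i.
rewrite !probability_upper_ray ?(ltnW iS)// -EFinB; congr EFin.
by rewrite (binomial_tailS R n i)//; ring.
Qed.

Lemma measurable_quantile_rv :
  measurable_fun [set: measurableTypeR R]
    (fun z : measurableTypeR R => lattice_point R n (quantile_index R n t z) :
        R).
Proof.
rewrite (_ : (fun z => _) = fun z => 2 * (\sum_(j < n) \1_(`]t j.+1,
    +oo[%classic) z) - n%:R); last first.
  apply/funext => z; rewrite /lattice_point natr_sum; congr (2 * _ - _).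
  by apply: eq_bigr => j _; rewrite indicE mem_setE in_itv /= andbT.
apply: measurable_funB => //; apply: measurable_funM => //.
by apply: measurable_sum => j; exact: measurable_indic.
Qed.

Definition quantile_rv : {RV normal_prob (0 : R) 1 >-> R} :=
  mfun_Sub (mem_set measurable_quantile_rv).

Lemma quantile_rv_law (A : set R) : measurable A ->
  distribution (normal_prob (0 : R) 1) quantile_rv A =
  (\sum_(k < n.+1 | lattice_point R n k \in A) binomial_half R n k)%:E.
Proof.
apply: (@finite_law R _ _ (normal_prob (0 : R) 1) quantile_rv 'I_n.+1
    quantile_cell).
- by move=> i; apply: measurableD; exact: measurable_upper_ray.
- move=> i j _ _ [z [/quantile_cellP zi /quantile_cellP zj]].
  by apply/val_inj; rewrite /= -zi -zj.
- exact: probability_quantile_cell.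
- by move=> i z /quantile_cellP <-.
- by rewrite -(big_mkord xpredT (binomial_half R n)) sum_binomial_half.
Qed.

End quantile_coupling.

Theorem lemma1 (R : realType) :
  exists n0 : nat,
    forall (d : measure_display) (T : measurableType d) (P : probability T R)
      (X : nat -> {RV P >-> R}),
    iid_symmetric_bernoulli X ->
    forall n : nat, (n0 <= n)%N ->
    exists (d' : measure_display) (T' : measurableType d')
      (Q : probability T' R) (S Z : {RV Q >-> R}),
      [/\ has_law S (distribution P (partial_sum X n)),
          has_law Z (normal_prob 0 1) &
          {ae Q, forall w,
            `|S w| <= `|Z w| * Num.sqrt n%:R + 3 /\
            `|S w - Z w * Num.sqrt n%:R| <= Z w ^+ 2 + 11}].
Proof.
(* The value 200 comes from [gauss_tail_le_binomial_half]. *)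
exists 200%N => d T P X iidX n n200.
have [t tP] := quantile_thresholds_exist R n.
exists _, (measurableTypeR R), (normal_prob (0 : R) 1), (quantile_rv R n t),
    (std_normal_id R).
split => //.
- by move=> A mA; rewrite quantile_rv_law// partial_sum_law.
(* The bounds hold at every point, not only almost surely. *)
- apply: aeW => z /=.
  have [i [le_in ti ti1]] := threshold_cell_exists R t z n.
  rewrite (quantile_indexE R n t tP z i)//.
  by apply: (quantile_bounds R n t tP) => // i0; exact/ltW/ti.
Qed.
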